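(* Let $n\ge1$, $p\in\{1,2\}$, and let $f:\mathbb{R}^n\to\mathbb{R}$ satisfy: (i) $f$ is $p$ times continuously differentiable on $\mathbb{R}^n$; (ii) there is a constant $f_{\rm low}$ with $f(x)\ge f_{\rm low}$ for all $x\in\mathbb{R}^n$; (iii) there is a constant $L_p\ge 0$ with $\|\nabla_x^p f(x)-\nabla_x^p f(y)\|\le L_p\|x-y\|$ for all $x,y\in\mathbb{R}^n$. (a) If $p=1$, the OFFAR1 algorithm requires at most $$\left[\frac{4\sigma_{\max}}{\vartheta^2}\left(\frac{L_1}{\sigma_0}+\vartheta\theta_1\right)^2\left[f(x_0)-f_{\rm low}+\frac12\left(\frac{L_1}{\sigma_0}\nu_{\max}+\vartheta\sigma_0\right)\right]+\left(\frac{2L_1}{\vartheta}\left(\frac{L_1}{\sigma_0}+\theta_1\right)\right)^2\right]\epsilon_1^{-2}+2$$ iterations and evaluations of the gradient to produce a vector $x_\epsilon\in\mathbb{R}^n$ such that $\|g(x_\epsilon)\|\le\epsilon_1$. (b) If $p=2$ and, in addition, there is a constant $\kappa_{\rm high}\le0$ with $\min_{\|d\|\le1}\nabla_x^2f(x)[d]^2\ge\kappa_{\rm high}$ for all $x\in\mathbb{R}^n$, the OFFAR2 algorithm requires at most $$\left[\frac{12\,\sigma_{\max}^{1/2}}{(2\vartheta)^{3/2}}\left(\frac{L_2}{\sigma_0}+\vartheta\theta_1\right)^{\frac32}\left[f(x_0)-f_{\rm low}+\frac16\left(\frac{L_2}{\sigma_0}\nu_{\max}+\vartheta\sigma_0\right)\right]+\left(\frac{L_2}{\vartheta}\left(\frac{L_2}{\sigma_0}+\theta_1\right)\right)^{\frac32}\right]\epsilon_1^{-\frac32}+2$$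 iterations and evaluations of the gradient and Hessian to produce a vector $x_\epsilon\in\mathbb{R}^n$ such that $\|g(x_\epsilon)\|\le\epsilon_1$.
   Context: Notation: $\|\cdot\|$ is the Euclidean norm on $\mathbb{R}^n$ (and the induced operator norm for tensors); $\nabla_x^i f(x)$ is the $i$th derivative tensor of $f$ at $x$, and $T[d]^i$ is the tensor $T$ applied to $i$ copies of $d$; $g(x)=\nabla_x^1 f(x)$, $g_k=g(x_k)$. The Taylor expansion is $T_{f,p}(x,s)=f(x)+\sum_{i=1}^p\frac{1}{i!}\nabla_x^i f(x)[s]^i$, $\nabla_s^1T_{f,p}$ is its gradient in $s$, and the regularized model is $m_k(s)=T_{f,p}(x_k,s)+\frac{\sigma_k}{(p+1)!}\|s\|^{p+1}$. OFFAR$p$ algorithm (OFFAR1 for $p=1$, OFFAR2 for $p=2$). Inputs: $x_0\in\mathbb{R}^n$, $\nu_0>0$, $\epsilon_1\in(0,1]$, $\theta_1>1$, $\vartheta\in(0,1]$. Set $k=0$. Step 1: evaluate $g_k$; terminate with $x_\epsilon=x_k$ if $\|g_k\|\le\epsilon_1$; else evaluate $\{\nabla_x^if(x_k)\}_{i=2}^p$. Step 2: if $k>0$, set $\mu_{1,k}=\frac{p!\,\|g_k\|}{\|s_{k-1}\|^p}-\theta_1\sigma_{k-1}$ and select $\sigma_k\in[\vartheta\nu_k,\max(\nu_k,\mu_{1,k})]$; if $k=0$, set $\sigma_0=\mu_{1,0}=\nu_0$. Then compute a step $s_k$ with $m_k(s_k)-m_k(0)<0$ and $\|\nabla_s^1T_{f,p}(x_k,s_k)\|\le\theta_1\frac{\sigma_k}{p!}\|s_k\|^p$.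 Step 3: set $x_{k+1}=x_k+s_k$, $\nu_{k+1}=\nu_k+\nu_k\|s_k\|^{p+1}$, increment $k$ by one and return to Step 1. Constants (empty sums are $0$; $\kappa_{\rm high}=0$ if $p=1$): $$\eta=\sum_{i=2}^p\left[\frac{\max[0,-\kappa_{\rm high}](p+1)!}{i!\,\vartheta\nu_0}\right]^{\frac{1}{p-i+1}},$$ $$\kappa_1=1+2^{2p+1}\eta^{p+1}+2^{2p+1}\left[\frac{p+1}{\vartheta}\left((1+\theta_1)\frac{L_p}{\sigma_0}+\theta_1\right)\right]^{\frac{p+1}{p}},$$ $$\nu_{\max}=\max\left[\sigma_0+\sigma_0\left(2\eta+2\left(\frac{(p+1)!\,\|g_0\|}{\sigma_0}\right)^{\frac1p}\right)^{p+1},\ \frac{2\kappa_1L_p}{\vartheta}\right],$$ $$\sigma_{\max}=\max\left[\frac{2(p+1)!}{\vartheta}\left(f(x_0)-f_{\rm low}+\frac{1}{(p+1)!}\left(\frac{L_p}{\sigma_0}\nu_{\max}+\vartheta\sigma_0\right)\right)+\nu_{\max},\ L_p,\ \nu_0\right].$$ *)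

(* Defs.v *)
From mathcomp Require Import all_boot all_order all_algebra.
From mathcomp Require Import all_classical all_reals all_analysis.

Set Implicit Arguments.
Unset Strict Implicit.
Unset Printing Implicit Defensive.

Import Order.TTheory GRing.Theory Num.Theory.
Import numFieldNormedType.Exports.

Local Open Scope classical_set_scope.
Local Open Scope ring_scope.

Section Derivatives.
Variables (R : realType) (n : nat).
Implicit Types (f : 'rV[R]_n -> R) (x s : 'rV[R]_n).

(* The library norm `|x| on 'rV[R]_n is the sup norm. *)
Definition enorm (x : 'rV[R]_n) : R := Num.sqrt (\sum_(j < n) x 0 j ^+ 2).

(* nabla f [:: d_1; ...; d_i] x is nabla_x^i f(x)[d_1, ..., d_i]: the iterated
   Frechet derivative, d_i being the first direction of differentiation. *)
Fixpoint nabla f (ds : seq 'rV[R]_n) : 'rV[R]_n -> R :=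
  if ds is d :: ds' then fun x => 'd (nabla f ds') x d else f.

(* In finite dimension, the tensor-valued map nabla^i f is differentiable
   (resp. continuous) iff all its evaluations at fixed directions are. *)
Definition continuously_differentiable (p : nat) f : Prop :=
  (forall ds, (size ds < p)%N -> forall x, differentiable (nabla f ds) x) /\
  (forall ds, (size ds <= p)%N -> continuous (nabla f ds)).

(* Operator norm induced by enorm on order-i tensors. It is extended-real
   valued, so that no convention is needed for an unbounded T. *)
Definition tensor_norm (i : nat) (T : seq 'rV[R]_n -> R) : \bar R :=
  ereal_sup [set `|T d|%:E | d in
    [set d : i.-tuple 'rV[R]_n | forall j, enorm (tnth d j) <= 1]].

Definition lipschitz_nabla (p : nat) f (L : R) : Prop :=
  forall x y,
    (tensor_norm p (fun ds => (nabla f ds x - nabla f ds y)%R)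
       <= (L * enorm (x - y)%R)%:E)%E.

Definition grad f x : 'rV[R]_n := \row_(j < n) 'd f x (delta_mx 0 j).

Definition taylor f (p : nat) x s : R :=
  f x + \sum_(1 <= i < p.+1) (i`!%:R)^-1 * nabla f (nseq i s) x.

Definition reg_model f (p : nat) x (sigma : R) s : R :=
  taylor f p x s + sigma / (p.+1)`!%:R * enorm s ^+ p.+1.

End Derivatives.

Section Algorithm.
Variables (R : realType) (n : nat) (f : 'rV[R]_n -> R) (p : nat).
Variables (x0 : 'rV[R]_n) (nu0 eps1 theta1 vartheta : R).

Definition sigma_rule (x s : nat -> 'rV[R]_n) (sigma nu : nat -> R) (k : nat)
    : Prop :=
  if k is j.+1 then
    let mu := p`!%:R * enorm (grad f (x k)) / enorm (s j) ^+ p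
              - theta1 * sigma j in
    vartheta * nu k <= sigma k <= Num.max (nu k) mu
  else sigma 0%N = nu0.

Definition step_rule (x : 'rV[R]_n) (sigma : R) (s : 'rV[R]_n) : Prop :=
  reg_model f p x sigma s - reg_model f p x sigma 0 < 0 /\
  enorm (grad (taylor f p x) s) <= theta1 * (sigma / p`!%:R) * enorm s ^+ p.

(* The algorithm is nondeterministic (choice of sigma_k and s_k), so its
   executions are described by a relation. The sequences are total, but
   iteration k is constrained only if the test ||g_j|| <= eps1 has failed at
   every j <= k; entries past termination are arbitrary. *)
Definition offar_run (x s : nat -> 'rV[R]_n) (sigma nu : nat -> R) : Prop :=
  [/\ x 0%N = x0, nu 0%N = nu0 &
      forall k, (forall j, (j <= k)%N -> eps1 < enorm (grad f (x j))) ->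
        [/\ sigma_rule x s sigma nu k,
            step_rule (x k) (sigma k) (s k),
            x k.+1 = x k + s k &
            nu k.+1 = nu k + nu k * enorm (s k) ^+ p.+1]].

(* The run stops with x_eps = x K. It has then performed the K.+1 iterations
   0, ..., K (the last one reduced to the stopping test), K.+1 evaluations of
   the gradient, and K evaluations of the derivatives of order 2, ..., p. *)
Definition stops_at (x : nat -> 'rV[R]_n) (K : nat) : Prop :=
  enorm (grad f (x K)) <= eps1 /\
  forall j, (j < K)%N -> eps1 < enorm (grad f (x j)).

End Algorithm.

(* sigma_0 is nu0 throughout: the algorithm sets sigma_0 = nu_0.
   f0 and g0 stand for f(x_0) and ||g_0||. *)
Section Constants.
Variables (R : realType) (p : nat) (L nu0 theta1 vartheta kappa_high : R).

Definition eta : R :=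
  \sum_(2 <= i < p.+1)
    (Num.max 0 (- kappa_high) * (p.+1)`!%:R / (i`!%:R * vartheta * nu0))
      `^ ((p - i + 1)%N%:R)^-1.

Definition kappa1 : R :=
  1 + 2 ^+ (2 * p + 1) * eta ^+ p.+1
    + 2 ^+ (2 * p + 1) *
      (p.+1%:R / vartheta * ((1 + theta1) * (L / nu0) + theta1))
        `^ (p.+1%:R / p%:R).

Definition nu_max (g0 : R) : R :=
  Num.max
    (nu0 + nu0 *
       (2 * eta + 2 * ((p.+1)`!%:R * g0 / nu0) `^ (p%:R)^-1) ^+ p.+1)
    (2 * kappa1 * L / vartheta).

Definition sigma_max (f0 flow g0 : R) : R :=
  Num.max
    (Num.max
       (2 * (p.+1)`!%:R / vartheta *
          (f0 - flow
           + ((p.+1)`!%:R)^-1 * (L / nu0 * nu_max g0 + vartheta * nu0))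
        + nu_max g0)
       L)
    nu0.

End Constants.

(* Main.v *)
Require Import Defs.
From mathcomp Require Import all_boot all_order all_algebra.
From mathcomp Require Import all_classical all_reals all_analysis.
From mathcomp Require Import ring lra.

(* Write [r_j = ||s_j||], [q = (p+1)/p] and
   [D_k = \sum_(j < k) sigma_j r_j^(p+1)].  Taylor's bound and the model decrease
   give [(p+1)! (f x_(j+1) - f x_j) <= (L - sigma_j) r_j^(p+1)], hence
   [D_k <= (p+1)! (f x_0 - flow) + L \sum_(j < k) r_j^(p+1)].  As long as
   [vartheta nu_j < 2L], the last sum is controlled by the growth of [nu], since
   [nu_(j+1) - nu_j = nu_j r_j^(p+1) >= nu_0 r_j^(p+1)], and [nu] cannot jump
   above [nu_max]; afterwards [L <= sigma_j / 2], so that half of [D_k] absorbs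
   it.  This bounds [D_k], and then [sigma_j] by [sigma_max], uniformly in [k].
   On the other hand [||g_(j+1)|| > eps1] forces
   [1 <= sigma_j r_j^(p+1) sigma_max^(1/p) (w / (p! eps1))^q] with
   [w = L / (vartheta nu_0) + theta1].  Summing over [j], already the first term
   of the stated bound dominates the number of iterations. *)

Set Implicit Arguments.
Unset Strict Implicit.
Unset Printing Implicit Defensive.

Import Order.TTheory GRing.Theory Num.Theory.
Import numFieldNormedType.Exports.

Local Open Scope ring_scope.

(** * Euclidean norm and calculus along a line *)

Section EuclideanNorm.
Context {R : realType} {n : nat}.
Implicit Types (u v x : 'rV[R]_n) (a : R).

Definition dot u v : R := \sum_(j < n) u 0 j * v 0 j.

Lemma dotDl a u v x : dot (a *: u + v) x = a * dot u x + dot v x.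
Proof.
rewrite /dot mulr_sumr -big_split; apply: eq_bigr => i _ /=.
by rewrite !mxE mulrDl mulrA.
Qed.

Lemma dotC u v : dot u v = dot v u.
Proof. by apply: eq_bigr => i _; rewrite mulrC. Qed.

Lemma dotvv u : dot u u = enorm u ^+ 2.
Proof.
rewrite /enorm sqr_sqrtr; first by apply: eq_bigr => i _; rewrite expr2.
by apply: sumr_ge0 => i _; apply: sqr_ge0.
Qed.

Lemma enorm_ge0 u : 0 <= enorm u.
Proof. exact: sqrtr_ge0. Qed.

Lemma enorm0 : enorm (0 : 'rV[R]_n) = 0.
Proof. by rewrite /enorm big1 ?sqrtr0// => i _; rewrite mxE expr0n. Qed.

Lemma enormZ a u : enorm (a *: u) = `|a| * enorm u.
Proof.
rewrite /enorm -(sqrtr_sqr a) -sqrtrM ?sqr_ge0// mulr_sumr.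
by congr Num.sqrt; apply: eq_bigr => i _; rewrite mxE exprMn.
Qed.

Lemma enorm_eq0 u : enorm u = 0 -> u = 0.
Proof.
move=> u0; have /eqP : dot u u = 0 by rewrite dotvv u0 expr0n.
rewrite psumr_eq0 => [|i _]; last by rewrite -expr2 sqr_ge0.
move=> /allP u00; apply/rowP => i; rewrite mxE; apply/eqP.
by have := u00 i (mem_index_enum _); rewrite mulf_eq0 orbb.
Qed.

Lemma enormD_sq a u v :
  enorm (a *: u + v) ^+ 2 =
  a ^+ 2 * enorm u ^+ 2 + 2 * a * dot u v + enorm v ^+ 2.
Proof.
rewrite -!dotvv dotDl (dotC u) (dotC v (_ + _)) !dotDl (dotC v u); ring.
Qed.

(** The squared norm of the component of [v] orthogonal to [u] is nonnegative; multiplying it by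
    [enorm u ^+ 2] gives the squared inequality. *)
Lemma cauchy_schwarz u v : dot u v <= enorm u * enorm v.
Proof.
have [u0|u0] := eqVneq (enorm u) 0.
  rewrite u0 mul0r (enorm_eq0 u0) /dot big1// => i _.
  by rewrite mxE mul0r.
have up : 0 < enorm u by rewrite lt_neqAle eq_sym u0 enorm_ge0.
have [uv0|uv0] := leP (dot u v) 0.
  by rewrite (le_trans uv0)// mulr_ge0// enorm_ge0.
rewrite -(@ler_pXn2r _ 2)// ?nnegrE ?mulr_ge0 ?enorm_ge0// ?(ltW uv0)//.
have := sqr_ge0 (enorm ((- (dot u v / enorm u ^+ 2)) *: u + v)).
rewrite enormD_sq => H.
have : 0 <= enorm u ^+ 2 * ((- (dot u v / enorm u ^+ 2)) ^+ 2 * enorm u ^+ 2 +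
   2 * (- (dot u v / enorm u ^+ 2)) * dot u v + enorm v ^+ 2).
  by rewrite mulr_ge0// sqr_ge0.
rewrite -subr_ge0; congr (_ <= _); field; exact: u0.
Qed.

Lemma enormD u v : enorm (u + v) <= enorm u + enorm v.
Proof.
rewrite -(@ler_pXn2r _ 2)// ?nnegrE ?addr_ge0 ?enorm_ge0//.
rewrite -[u]scale1r enormD_sq scale1r sqrrD.
have := cauchy_schwarz u v; lra.
Qed.

End EuclideanNorm.

Section Calculus.
Local Open Scope classical_set_scope.
Context {R : realType}.

Lemma is_derive_continuous (phi dphi : R -> R) (a b : R) :
  (forall r : R, is_derive r 1 phi (dphi r)) ->
  {within `[a, b], continuous phi}.
Proof.
move=> dphiP; apply: derivable_within_continuous => r _.
exact: (@ex_derive _ _ _ _ _ _ _ (dphiP r)).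
Qed.

(** Subtracting from [phi] the primitive of the bound leaves a function with nonpositive derivative.
    This replaces integration in all the Taylor estimates below, where the bound is affine or
    quadratic in [r]. *)
Lemma increment_le_poly3 (phi dphi : R -> R) (a b c t : R) : 0 <= t ->
  (forall r : R, is_derive r 1 phi (dphi r)) ->
  (forall r : R, 0 <= r <= t -> dphi r <= a + 2 * b * r + 3 * c * r ^+ 2) ->
  phi t - phi 0 <= a * t + b * t ^+ 2 + c * t ^+ 3.
Proof.
move=> t0 dphiP bnd.
pose psi r := phi r - (a * r + b * r ^+ 2 + c * r ^+ 3).
(* As a formal polynomial, the primitive is differentiated algebraically. *)
pose p : {poly R} := a *: 'X + b *: 'X^2 + c *: 'X^3.
have pE r : p.[r] = a * r + b * r ^+ 2 + c * r ^+ 3.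
  by rewrite /p !hornerE.
have dpE r : p^`().[r] = a + 2 * b * r + 3 * c * r ^+ 2.
  rewrite /p !derivD !derivZ derivX !derivXn !hornerE /=; ring.
have dpsi (r : R) : is_derive r 1 psi (dphi r - (a + 2 * b * r + 3 * c * r ^+ 2)).
  have -> : psi = phi - horner p by apply/funext => z; rewrite /psi !fctE pE.
  by rewrite -dpE; apply: is_deriveB.
have := @ler0_derive1_nincr R psi 0 t (fun r _ => @ex_derive _ _ _ _ _ _ _ (dpsi r)).
move=> H; suff : psi t <= psi 0.
  by rewrite /psi !expr0n/= !mulr0 !addr0 subr0; lra.
apply: H => //; last exact: is_derive_continuous dpsi.
move=> r; rewrite in_itv/= => /andP[r0 rt].
rewrite derive1E (@derive_val _ _ _ _ _ _ _ (dpsi r)) subr_le0.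
by apply: bnd; rewrite !ltW.
Qed.

Lemma is_derive_line n (h : 'rV[R]_n -> R) (x s : 'rV[R]_n) (t : R) :
  differentiable h (x + t *: s) ->
  is_derive t 1 (fun r : R => h (x + r *: s)) ('d h (x + t *: s) s).
Proof.
move=> dh.
have dl : is_diff t (fun r : R => x + r *: s) (fun r : R => r *: s).
  have := is_diffD (is_diff_cst x t) (is_diff_scalel t s).
  by rewrite add0r.
have dhc : differentiable (h \o (fun r : R => x + r *: s)) t.
  exact: differentiable_comp.
apply: DeriveDef; first exact/derivable1_diffP.
rewrite -derive1E derive1E'//.
by rewrite diff_comp//= (@diff_val _ _ _ _ _ _ _ dl) scale1r.
Qed.

End Calculus.

(** * Symmetry of the Hessian and Taylor estimates *)

Section Tensors.
Context {R : realType} {n : nat}.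
Implicit Types (f : 'rV[R]_n -> R) (x y s d u v : 'rV[R]_n) (L : R).

Lemma dot_grad f x d : dot (grad f x) d = 'd f x d.
Proof.
rewrite [in RHS](row_sum_delta d) linear_sum; apply: eq_bigr => j _.
by rewrite mxE linearZ /= mulrC.
Qed.

(** This turns a bound on all products [dot u d] into a bound on [enorm u], by taking [d = u]. *)
Lemma enorm_le_dot u C : 0 <= C -> dot u u <= C * enorm u -> enorm u <= C.
Proof.
move=> C0; rewrite dotvv expr2; have [->//|u0] := eqVneq (enorm u) 0.
by rewrite ler_pM2r// lt_neqAle eq_sym u0 enorm_ge0.
Qed.

(** Asking for [<= 1] instead of equality covers [u = 0], where the inverse of the norm is [0] and
    so is the witness. *)
Lemma enorm_normalize u : exists2 e, enorm e <= 1 & u = enorm u *: e.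
Proof.
exists ((enorm u)^-1 *: u).
  rewrite enormZ ger0_norm ?invr_ge0 ?enorm_ge0//.
  have [->|u0] := eqVneq (enorm u) 0; first by rewrite mulr0 ler01.
  by rewrite mulVf.
have [u0|u0] := eqVneq (enorm u) 0; first by rewrite (enorm_eq0 u0) !scaler0.
by rewrite scalerA divff// scale1r.
Qed.

Lemma tensor_norm_le p (T : seq 'rV[R]_n -> R) C (d : p.-tuple 'rV[R]_n) :
  (tensor_norm p T <= C%:E)%E -> (forall j, enorm (tnth d j) <= 1) ->
  `|T d| <= C.
Proof.
move=> TC d1; rewrite -lee_fin; apply: le_trans TC.
by apply: ereal_sup_ubound; exists d.
Qed.

(** The tensor norm only tests directions in the unit ball; linearity of the differential rescales
    to an arbitrary [d]. *)
Lemma lipschitz_diff f L x y d : lipschitz_nabla 1 f L ->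
  `|'d f x d - 'd f y d| <= L * enorm (x - y) * enorm d.
Proof.
move=> /(_ x y) Lf; have [e e1 de] := enorm_normalize d.
have dE z : 'd f z d = enorm d * 'd f z e.
  by rewrite {1}de linearZ.
have -> : 'd f x d - 'd f y d = enorm d * ('d f x e - 'd f y e).
  by rewrite [RHS]mulrBr; congr (_ - _); exact: dE.
rewrite normrM.
rewrite (ger0_norm (enorm_ge0 d)).
rewrite mulrC.
rewrite ler_wpM2r ?enorm_ge0//.
apply: (@tensor_norm_le 1 _ _ [tuple e] Lf) => j.
by rewrite (tnth_nth 0) ord1.
Qed.

Section TwiceDifferentiable.
Variable f : 'rV[R]_n -> R.
Hypothesis df : continuously_differentiable 2 f.

Notation "'H" := (fun x u v => nabla f [:: u; v] x) (at level 0).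

Lemma differentiable0 x : differentiable f x.
Proof. by have := df.1 [::] isT x. Qed.

Lemma differentiable1 v x : differentiable (nabla f [:: v]) x.
Proof. exact: df.1. Qed.

Lemma hessDl x a u v w :
  'H x (a *: u + v) w = a * 'H x u w + 'H x v w.
Proof. exact: (linearP ('d (nabla f [:: w]) x) a u v). Qed.

Lemma hessDr x a u v w :
  'H x w (a *: u + v) = a * 'H x w u + 'H x w v.
Proof.
(* The second slot is the direction differentiated first, so linearity in it is an identity between
   functions, which is then differentiated once more. *)
have fE : nabla f [:: a *: u + v] = a *: nabla f [:: u] + nabla f [:: v].
  apply/funext => y; exact: (linearP ('d f y) a u v).
rewrite -[LHS]/('d (nabla f [:: a *: u + v]) x w) fE.
have dv := differentiable1 v x.
have du := differentiableZ a (differentiable1 u x).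
rewrite (diffD du dv).
by rewrite -[LHS]/('d (a *: nabla f [:: u]) x w + _) (diffZ a (differentiable1 u x)).
Qed.

Lemma hess0l x w : 'H x 0 w = 0.
Proof. exact: (linear0 ('d (nabla f [:: w]) x)). Qed.

Lemma hessZl x a u w : 'H x (a *: u) w = a * 'H x u w.
Proof. by rewrite -[a *: u]addr0 hessDl hess0l addr0. Qed.

Lemma hess0r x w : 'H x w 0 = 0.
Proof. by have := hessDr x (-1) 0 0 w; rewrite scaler0 addr0 => ->; ring. Qed.

Lemma hessZr x a u w : 'H x w (a *: u) = a * 'H x w u.
Proof. by rewrite -[a *: u]addr0 hessDr hess0r addr0. Qed.

Lemma lipschitz_hess L x y u v : lipschitz_nabla 2 f L ->
  `|'H x u v - 'H y u v| <= L * enorm (x - y) * enorm u * enorm v.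
Proof.
move=> /(_ x y) Lf.
have [e e1 ue] := enorm_normalize u; have [e' e1' ve] := enorm_normalize v.
have HE z : 'H z u v = enorm u * (enorm v * 'H z e e').
  by rewrite {1}ue hessZl {1}ve hessZr.
have -> : 'H x u v - 'H y u v =
    enorm u * (enorm v * ('H x e e' - 'H y e e')).
  by rewrite [in RHS]mulrBr [RHS]mulrBr; congr (_ - _); exact: HE.
rewrite !normrM !(ger0_norm (enorm_ge0 _)).
rewrite mulrA mulrC -mulrA ler_wpM2r ?mulr_ge0 ?enorm_ge0//.
apply: (@tensor_norm_le 2 _ _ [tuple e; e'] Lf) => j.
by rewrite (tnth_nth 0); case: j => -[|[|//]] i /=.
Qed.

(** Two applications of the mean value theorem: along [u] to the difference of [f] on two parallel
    segments, then along [v] to the derivative of [f] in direction [u]. *)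
Lemma second_difference x u v (t : R) : 0 < t -> exists y,
  enorm (y - x) <= t * (enorm u + enorm v) /\
  f (x + t *: v + t *: u) - f (x + t *: u) - (f (x + t *: v) - f x)
    = t ^+ 2 * 'H y v u.
Proof.
move=> t0.
have d1 (r : R) : is_derive r 1
    ((fun r : R => f (x + t *: v + r *: u)) - (fun r : R => f (x + r *: u)))
    ('d f (x + t *: v + r *: u) u - 'd f (x + r *: u) u).
  by apply: is_deriveB; apply: is_derive_line; exact: differentiable0.
have [c] := MVT t0 (fun r _ => d1 r) (is_derive_continuous d1).
rewrite in_itv/= => /andP[c0 ct].
rewrite !fctE !scale0r !addr0 subr0 => ->.
have d2 (r : R) : is_derive r 1
    (fun r : R => nabla f [:: u] (x + c *: u + r *: v))
    ('d (nabla f [:: u]) (x + c *: u + r *: v) v).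
  by apply: is_derive_line; exact: differentiable1.
have [z] := MVT t0 (fun r _ => d2 r) (is_derive_continuous d2).
rewrite in_itv/= => /andP[z0 zt].
rewrite !scale0r !addr0 subr0 [x + t *: v + _]addrAC => e.
exists (x + c *: u + z *: v); split; last first.
  apply: (etrans (congr1 (fun w => w * t) e)).
  by rewrite -mulrA -expr2 mulrC.
rewrite -(addrA x) [_ - x]addrC addKr (le_trans (enormD _ _))// !enormZ !gtr0_norm//.
by rewrite mulrDr lerD// ler_wpM2r ?enorm_ge0// ltW.
Qed.

(* Schwarz's theorem: both orders of differentiation are compared with the same
   second difference. *)
Lemma hess_sym L x u v : 0 <= L -> lipschitz_nabla 2 f L ->
  'H x u v = 'H x v u.
Proof.
move=> L0 Lf; apply/eqP; rewrite -subr_eq0 -normr_le0 leNgt; apply/negP.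
set D := `|_| => D0.
pose C := 2 * L * (enorm u + enorm v) * enorm u * enorm v.
have C0 : 0 <= C by rewrite !mulr_ge0 ?addr_ge0 ?enorm_ge0.
suff DC t : 0 < t -> D <= C * t.
  have C1 : 0 < C + 1 by lra.
  (* This [t] yields [D * (C + 1) <= C * D], against [0 < D]; the [+ 1] allows [C = 0]. *)
  have /DC : 0 < D / (C + 1) by rewrite divr_gt0.
  rewrite mulrA ler_pdivlMr//; nra.
move=> t0.
have [y [yx ey]] := second_difference x u v t0.
have [z [zx ez]] := second_difference x v u t0.
(* The second difference is symmetric in [u] and [v] after regrouping its four terms. *)
have yz : 'H y v u = 'H z u v.
  have t20 : t ^+ 2 != 0 by rewrite expf_neq0// gt_eqF.
  apply: (mulfI t20); rewrite -ey -ez.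
  rewrite [x + t *: u + t *: v]addrAC.
  have swap (a b c d : R) : a - b - (c - d) = a - c - (b - d) by ring.
  exact: swap.
have Hy := lipschitz_hess y x v u Lf.
have Hz := lipschitz_hess z x u v Lf.
have tri (a b c d : R) : a = b -> `|c - d| <= `|a - d| + `|b - c|.
  by move=> ->; rewrite (distrC b c) [leRHS]addrC; apply: ler_distD.
apply: (le_trans (tri _ _ _ _ yz)); apply: le_trans (lerD Hy Hz) _.
rewrite /C.
have : 0 <= L * enorm u * enorm v by rewrite !mulr_ge0 ?enorm_ge0.
move=> k0.
have h1 := ler_wpM2l k0 yx; have h2 := ler_wpM2l k0 zx.
lra.
Qed.

End TwiceDifferentiable.

End Tensors.

Section Taylor.
Context {R : realType} {n : nat}.
Implicit Types (f : 'rV[R]_n -> R) (x y s d u v : 'rV[R]_n) (L : R).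

Lemma taylor1E f x s : taylor f 1 x s = f x + 'd f x s.
Proof. by rewrite /taylor big_nat1 invr1 mul1r. Qed.

Lemma taylor2E f x s :
  taylor f 2 x s = f x + 'd f x s + 2^-1 * nabla f [:: s; s] x.
Proof.
by rewrite /taylor big_ltn// big_nat1 invr1 mul1r addrA.
Qed.

(** At [x + r *: s] the derivative along [s] exceeds its value at [x] by at most
    [L * r * enorm s ^+ 2]; integrate over [[0, 1]]. *)
Lemma taylor1_upper f L x s :
  continuously_differentiable 1 f -> lipschitz_nabla 1 f L ->
  f (x + s) <= taylor f 1 x s + L / 2 * enorm s ^+ 2.
Proof.
move=> df Lf.
have df0 y : differentiable f y by have := df.1 [::] isT y.
have := @increment_le_poly3 R (fun r => f (x + r *: s)) _
  ('d f x s) (L / 2 * enorm s ^+ 2) 0 1 ler01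
  (fun r => is_derive_line (df0 (x + r *: s))).
rewrite scale1r scale0r addr0 !expr1n !mulr1 addr0 taylor1E => H.
have shift (a b c e : R) : a - b <= c + e -> a <= b + c + e.
  by rewrite lerBlDl !addrA.
apply: shift; apply: H => r /andP[r0 _].
have := lipschitz_diff (x + r *: s) x s Lf.
rewrite [x + _ - x]addrC addKr enormZ (ger0_norm r0) => H.
have := le_trans (ler_norm _) H.
have bnd (a b l e : R) : a - b <= l * (r * e) * e ->
  a <= b + 2 * (l / 2 * e ^+ 2) * r + 3 * 0 * r ^+ 2 by move=> h; nra.
exact: bnd.
Qed.

Lemma taylor1_grad f L x s d : lipschitz_nabla 1 f L ->
  'd f (x + s) d - 'd f x d <= L * enorm s * enorm d.
Proof.
move=> Lf; have := lipschitz_diff (x + s) x d Lf.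
rewrite [x + _ - x]addrC addKr; exact/le_trans/ler_norm.
Qed.

(** The first-order argument applied to the derivative of [f] in a fixed direction [d]. Keeping [d]
    free serves both [taylor2_upper] (with [d = s]) and the vector bound in [grad_upper]. *)
Lemma taylor2_grad f L x s d :
  continuously_differentiable 2 f -> lipschitz_nabla 2 f L ->
  'd f (x + s) d - 'd f x d <=
    nabla f [:: s; d] x + L / 2 * enorm s ^+ 2 * enorm d.
Proof.
move=> df Lf.
have := @increment_le_poly3 R (fun r => nabla f [:: d] (x + r *: s)) _
  (nabla f [:: s; d] x) (L / 2 * enorm s ^+ 2 * enorm d) 0 1 ler01
  (fun r => is_derive_line (differentiable1 df d (x + r *: s))).
rewrite scale1r scale0r addr0 !expr1n !mulr1 addr0 => H.
apply: H => r /andP[r0 _].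
have := lipschitz_hess df (x + r *: s) x s d Lf.
rewrite [x + _ - x]addrC addKr enormZ (ger0_norm r0) => H.
have := le_trans (ler_norm _) H.
have bnd (a b l e k : R) : a - b <= l * (r * e) * e * k ->
  a <= b + 2 * (l / 2 * e ^+ 2 * k) * r + 3 * 0 * r ^+ 2.
  by move=> h; have -> : b + 2 * (l / 2 * e ^+ 2 * k) * r + 3 * 0 * r ^+ 2 =
    b + l * (r * e) * e * k; [field | lra].
exact: bnd.
Qed.

(** Integrates [taylor2_grad], taken at step [r *: s] in direction [s], for [r] from 0 to 1. *)
Lemma taylor2_upper f L x s :
  continuously_differentiable 2 f -> lipschitz_nabla 2 f L ->
  f (x + s) <= taylor f 2 x s + L / 6 * enorm s ^+ 3.
Proof.
move=> df Lf.
have := @increment_le_poly3 R (fun r => f (x + r *: s)) _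
  ('d f x s) (2^-1 * nabla f [:: s; s] x) (L / 6 * enorm s ^+ 3) 1 ler01
  (fun r => is_derive_line (differentiable0 df (x + r *: s))).
rewrite scale1r scale0r addr0 !expr1n !mulr1 taylor2E => H.
have shift (a b c e k : R) : a - b <= c + e + k -> a <= b + c + e + k.
  by rewrite lerBlDl !addrA.
apply: shift; apply: H => r /andP[r0 _].
have := taylor2_grad x (r *: s) s df Lf.
rewrite enormZ (ger0_norm r0).
have -> : nabla f [:: r *: s; s] x = r * nabla f [:: s; s] x by exact: hessZl.
have bnd (a b l e k : R) : a - b <= r * k + l / 2 * (r * e) ^+ 2 * e ->
  a <= b + 2 * (2^-1 * k) * r + 3 * (l / 6 * e ^+ 3) * r ^+ 2.
  move=> h; have -> : 2 * (2^-1 * k) * r = r * k by field.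
  have -> : 3 * (l / 6 * e ^+ 3) * r ^+ 2 = l / 2 * (r * e) ^+ 2 * e by field.
  lra.
exact: bnd.
Qed.

Lemma dot_grad_taylor1 f x s d : continuously_differentiable 1 f ->
  dot (grad (taylor f 1 x) s) d = 'd f x d.
Proof.
move=> df; have df0 : differentiable f x by have := df.1 [::] isT x.
rewrite dot_grad.
pose l : 'rV[R]_n -> R := 'd f x.
have -> : taylor f 1 x = cst (f x) + l.
  by apply/funext => y; rewrite taylor1E.
have cf := diff_continuous df0.
have dl : is_diff s l l.
  apply: DiffDef; first exact: (linear_differentiable s cf).
  exact: (diff_lin s cf).
have dT := is_diffD (is_diff_cst (f x) s) dl.
have TE : 'd (cst (f x) + l) s = 0 + l :> ('rV[R]_n -> R).
  exact: diff_val.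
apply: (etrans (congr1 (fun h : 'rV[R]_n -> R => h d) TE)).
exact: add0r.
Qed.

(** Along [s + r *: d] the Taylor model is a quadratic polynomial in [r], so its derivative at
    [r = 0] can be read off. The Lipschitz hypothesis enters through [hess_sym], which merges the
    two cross terms. *)
Lemma dot_grad_taylor2 f L x s d : 0 <= L ->
  continuously_differentiable 2 f -> lipschitz_nabla 2 f L ->
  dot (grad (taylor f 2 x) s) d = 'd f x d + nabla f [:: s; d] x.
Proof.
move=> L0 df Lf; rewrite dot_grad.
have cf := diff_continuous (differentiable0 df x).
pose q y := nabla f [:: y; y] x.
(* Expanding the second slot in the canonical basis shows [q] as a sum of products of linear forms,
   hence differentiable. *)
have qE : q = \sum_(j < n) ((fun y => y 0 j) *
    ('d (nabla f [:: delta_mx 0 j]) x : 'rV[R]_n -> R)).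
  apply/funext => y; rewrite fct_sumE /q.
  rewrite {2}(row_sum_delta y).
  rewrite (big_morph (fun v => nabla f [:: y; v] x) (id1 := 0) (op1 := +%R)).
  - by apply: eq_bigr => j _; exact: hessZr.
  - by move=> v w; have := hessDr df x 1 v w y; rewrite scale1r mul1r.
  - exact: hess0r.
have dq : differentiable q s.
  rewrite qE; apply: differentiable_sum => j; apply: differentiableM.
    exact: differentiable_coord.
  exact/linear_differentiable/diff_continuous/(differentiable1 df).
pose l : 'rV[R]_n -> R := 'd f x.
have TE : taylor f 2 x = cst (f x) + l + 2^-1 *: q.
  by apply/funext => y; rewrite taylor2E.
have dT : differentiable (taylor f 2 x) s.
  rewrite TE; apply: differentiableD; last exact: differentiableZ.
  apply: differentiableD; first exact: differentiable_cst.
  exact: (linear_differentiable s cf).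
have D1 : is_derive (0 : R) 1 (fun r => taylor f 2 x (s + r *: d))
    ('d (taylor f 2 x) s d).
  (* A variable base point lets [s + 0 *: d] be replaced by [s] inside the differential. *)
  have D1 y : s + (0 : R) *: d = y -> differentiable (taylor f 2 x) y ->
      is_derive (0 : R) 1 (fun r => taylor f 2 x (s + r *: d))
        ('d (taylor f 2 x) y d).
    by move=> <-; exact: is_derive_line.
  by apply: D1 dT; rewrite scale0r addr0.
pose p : {poly R} := (taylor f 2 x s)%:P + ('d f x d + nabla f [:: s; d] x) *: 'X
  + (2^-1 * nabla f [:: d; d] x) *: 'X^2.
have pE r : taylor f 2 x (s + r *: d) = p.[r].
  rewrite /p !hornerE !taylor2E [s + _]addrC.
  have lE : 'd f x (r *: d + s) = r * 'd f x d + 'd f x s.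
    exact: (linearP ('d f x) r d s).
  have qqE : nabla f [:: r *: d + s; r *: d + s] x =
      r * (r * nabla f [:: d; d] x + nabla f [:: s; d] x) +
      (r * nabla f [:: s; d] x + nabla f [:: s; s] x).
    apply: (etrans (hessDl f x r d s _)).
    apply: (congr2 (fun a b => r * a + b)).
      apply: (etrans (hessDr df x r d s d)).
      apply: (congr1 (fun a => _ + a)); exact: (hess_sym df x d s L0 Lf).
    exact: (hessDr df x r d s s).
  have ringE (k a b c e g h : R) : b = r * a + e -> c = r * (r * g + h) + (r * h + k) ->
      forall z, z + b + 2^-1 * c =
      z + e + 2^-1 * k + (a + h) * r + 2^-1 * g * r * r.
    by move=> -> -> z; field.
  exact: (ringE _ _ _ _ _ _ _ lE qqE (f x)).
have D2 : is_derive (0 : R) 1 (fun r => taylor f 2 x (s + r *: d)) p^`().[0].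
  have -> : (fun r => taylor f 2 x (s + r *: d)) = horner p by apply/funext.
  exact: is_derive_poly.
apply: (etrans (esym (@derive_val _ _ _ _ _ _ _ D1))).
apply: (etrans (@derive_val _ _ _ _ _ _ _ D2)).
rewrite /p !derivD !derivZ derivX derivXn derivC !hornerE /=.
by rewrite ?expr1 ?mulr0 ?mul0r ?mul0rn ?mulr0 ?addr0 ?mulr1.
Qed.

End Taylor.

(** * The evolution of the regularization parameter *)

(** Both sides are compared with the [k]-th power of twice the maximum of [a] and [b]. *)
Lemma exprD_le (R : realDomainType) (a b : R) k : 0 <= a -> 0 <= b ->
  (a + b) ^+ k <= 2 ^+ k * (a ^+ k + b ^+ k).
Proof.
move=> a0 b0; have M0 : 0 <= Num.max a b by rewrite le_max a0.
apply: (@le_trans _ _ ((2 * Num.max a b) ^+ k)).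
  rewrite lerXn2r ?nnegrE ?addr_ge0 ?mulr_ge0//.
  by rewrite mulr_natl mulr2n lerD// le_max lexx ?orbT.
rewrite exprMn ler_wpM2l ?exprn_ge0//.
by case: (leP a b) => _; rewrite ?lerDr ?lerDl exprn_ge0.
Qed.

Lemma powR_expr_succ_div (R : realType) (a : R) p : (0 < p)%N -> 0 <= a ->
  (a ^+ p) `^ (p.+1%:R / p%:R) = a ^+ p.+1.
Proof.
move=> p0 a0; rewrite -powR_mulrn// -powRrM mulrCA mulfV ?mulr1 ?powR_mulrn//.
by rewrite pnatr_eq0 -lt0n.
Qed.

Lemma powR_inv_expr_succ (R : realType) (a : R) p : (0 < p)%N -> 0 <= a ->
  (a `^ (p%:R)^-1) ^+ p.+1 = a `^ (p.+1%:R / p%:R).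
Proof.
by move=> p0 a0; rewrite -powR_mulrn ?powR_ge0// -powRrM mulrC.
Qed.

Lemma powR_succ_div (R : realType) (a : R) p : (0 < p)%N -> 0 < a ->
  a `^ (p.+1%:R / p%:R) = a * a `^ (p%:R)^-1.
Proof.
move=> p0 a0; rewrite -natr1 mulrDl mulfV ?pnatr_eq0 -?lt0n// mul1r.
by rewrite powRD ?powRr1 ?ltW//; apply/implyP => _; rewrite gt_eqF.
Qed.

Section Constants.
Context {R : realType}.
Implicit Types (p : nat) (L nu theta vartheta kappa g : R).

Lemma eta_ge0 p nu vartheta kappa : 0 <= eta p nu vartheta kappa.
Proof. by apply: sumr_ge0 => i _; exact: powR_ge0. Qed.

Lemma kappa1_ge1 p L nu theta vartheta kappa :
  1 <= kappa1 p L nu theta vartheta kappa.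
Proof.
by rewrite /kappa1 -addrA lerDl addr_ge0// mulr_ge0 ?exprn_ge0 ?eta_ge0 ?powR_ge0.
Qed.

Lemma nu_max_ge p L nu theta vartheta kappa g : 0 < nu ->
  nu <= nu_max p L nu theta vartheta kappa g.
Proof.
move=> nu_gt0; rewrite /nu_max le_max lerDl mulr_ge0 ?(ltW nu_gt0)// exprn_ge0//.
by rewrite addr_ge0// mulr_ge0 ?powR_ge0// eta_ge0.
Qed.

Lemma gap_ge0 p L nu theta vartheta kappa g (f0 flow : R) :
  0 <= L -> 0 < nu -> 0 < vartheta -> flow <= f0 ->
  0 <= f0 - flow + ((p.+1)`!%:R)^-1 *
    (L / nu * nu_max p L nu theta vartheta kappa g + vartheta * nu).
Proof.
move=> L0 nu_gt0 vt0 ff; rewrite addr_ge0 ?subr_ge0// mulr_ge0 ?invr_ge0//.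
have numax0 := le_trans (ltW nu_gt0) (nu_max_ge p L theta vartheta kappa g nu_gt0).
by rewrite addr_ge0 ?mulr_ge0 ?invr_ge0 ?(ltW vt0) ?(ltW nu_gt0).
Qed.

End Constants.

(** * The complexity argument for abstract scalar sequences *)

Section Core.
Context {R : realType} (p N : nat) (L nu0 theta1 vartheta kappa flow : R).
(** [r], [G] and [F] stand for the step norms, gradient norms and function values of a run. The
    recurrences are assumed only for [j < N], because a run is unconstrained once the stopping test
    succeeds. *)
Context (sigma nu r G F : nat -> R).
Hypotheses (p0 : (0 < p)%N) (L0 : 0 <= L) (nu00 : 0 < nu0)
  (theta1_gt1 : 1 < theta1) (vt01 : 0 < vartheta <= 1).
Hypotheses (r_ge0 : forall j, 0 <= r j) (G_ge0 : forall j, 0 <= G j)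
  (F_ge : forall j, flow <= F j).
Hypothesis nu_0 : nu 0%N = nu0.
Hypothesis nuS : forall j, (j < N)%N -> nu j.+1 = nu j + nu j * r j ^+ p.+1.
Hypothesis sigma_ge : forall j, (j < N)%N -> vartheta * nu j <= sigma j.
Hypothesis sigma_le : forall j, (j < N)%N -> sigma j <= Num.max (nu j) L.
Hypothesis G_le : forall j, (j < N)%N ->
  p`!%:R * G j.+1 <= (L + theta1 * sigma j) * r j ^+ p.
Hypothesis F_decr : forall j, (j < N)%N ->
  (p.+1)`!%:R * F j.+1 <= (p.+1)`!%:R * F j + (L - sigma j) * r j ^+ p.+1.

Local Notation et := (eta p nu0 vartheta kappa).

Hypothesis r_le : forall j, (j < N)%N ->
  r j <= et + ((p.+1)`!%:R * G j / sigma j) `^ (p%:R)^-1.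
Hypothesis sigma_0 : (0 < N)%N -> sigma 0%N = nu0.

Local Notation B := (p.+1%:R / vartheta * ((1 + theta1) * (L / nu0) + theta1)).
Local Notation numax := (nu_max p L nu0 theta1 vartheta kappa (G 0%N)).
Local Notation sigmax :=
  (sigma_max p L nu0 theta1 vartheta kappa (F 0%N) flow (G 0%N)).
Local Notation Delta := (F 0%N - flow
  + ((p.+1)`!%:R)^-1 * (L / nu0 * numax + vartheta * nu0)).

Let vt0 : 0 < vartheta. Proof. by case/andP: vt01. Qed.
Let th0 : 0 < theta1. Proof. exact: lt_trans theta1_gt1. Qed.
Let t0 : 0 <= L / nu0. Proof. by rewrite divr_ge0// ltW. Qed.

Lemma B_ge0 : 0 <= B.
Proof.
rewrite mulr_ge0 ?divr_ge0 ?(ltW vt0)// addr_ge0 ?(ltW th0)//.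
by rewrite mulr_ge0// addr_ge0 ?(ltW th0).
Qed.

Lemma nu_ge j : (j <= N)%N -> nu0 <= nu j.
Proof.
elim: j => [|j IH] jN; first by rewrite nu_0.
rewrite nuS//; have := IH (ltnW jN) => nuj.
rewrite (le_trans nuj)// lerDl mulr_ge0 ?exprn_ge0//.
by rewrite (le_trans _ nuj)// ltW.
Qed.

Lemma nu_gt0 j : (j <= N)%N -> 0 < nu j.
Proof. by move=> /nu_ge; apply: lt_le_trans. Qed.

Lemma sigma_gt0 j : (j < N)%N -> 0 < sigma j.
Proof.
by move=> jN; rewrite (lt_le_trans _ (sigma_ge jN))// mulr_gt0// nu_gt0// ltnW.
Qed.

(** [L] and [sigma j] are at most multiples of [nu j], while [sigma j.+1] is at least
    [vartheta * nu j.+1]. The quotient [nu j / nu j.+1] is kept because it later compensates a large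
    [r j]. *)
Lemma grad_ratio_le j : (j.+1 < N)%N ->
  (p.+1)`!%:R * G j.+1 / sigma j.+1 <= nu j / nu j.+1 * B * r j ^+ p.
Proof.
move=> jN; have jN' := ltnW jN.
have nuj := nu_gt0 (ltnW jN'); have nuj1 := nu_gt0 jN'.
have nu0j := nu_ge (ltnW jN').
rewrite ler_pdivrMr ?sigma_gt0//.
have rp : 0 <= r j ^+ p by rewrite exprn_ge0.
have sl : sigma j <= L + nu j.
  by rewrite (le_trans (sigma_le jN'))// ge_max lerDr lerDl L0 ltW.
have h1 : (p.+1)`!%:R * G j.+1 <= p.+1%:R * ((L + theta1 * sigma j) * r j ^+ p).
  by rewrite factS natrM -mulrA ler_wpM2l// G_le.
have h2 : L + theta1 * sigma j <= nu j * ((1 + theta1) * (L / nu0) + theta1).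
  have Lt : L <= nu j * (L / nu0).
    by rewrite mulrCA ler_peMr// ler_pdivlMr// mul1r.
  have h3 := ler_wpM2l (ltW th0) sl.
  have h4 := ler_wpM2l (ltW th0) Lt.
  lra.
have h5 : (p.+1)`!%:R * G j.+1 <=
    p.+1%:R * (nu j * ((1 + theta1) * (L / nu0) + theta1) * r j ^+ p).
  by rewrite (le_trans h1)// ler_wpM2l// ler_wpM2r.
apply: (le_trans h5).
have -> : p.+1%:R * (nu j * ((1 + theta1) * (L / nu0) + theta1) * r j ^+ p) =
   nu j / nu j.+1 * B * r j ^+ p * (vartheta * nu j.+1).
  by field; rewrite ?gt_eqF//.
rewrite ler_wpM2l ?sigma_ge//.
by rewrite mulr_ge0// mulr_ge0 ?B_ge0// divr_ge0 ?(ltW nuj) ?(ltW nuj1).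
Qed.

(* By [grad_ratio_le], [r_(j+1)^(p+1)] is bounded in terms of
   [(nu_j / nu_(j+1))^q r_j^(p+1)]; since [q >= 1], multiplying by [nu_(j+1)]
   leaves [nu_j r_j^(p+1) <= nu_(j+1)], whence the factor [kappa1]. *)
Lemma nuS_le_numax j : (j < N)%N -> vartheta * nu j < 2 * L ->
  nu j.+1 <= numax.
Proof.
move=> jN nuL.
have e0 := eta_ge0 p nu0 vartheta kappa.
have p_gt0 : 0 < p%:R :> R by rewrite ltr0n.
case: j jN nuL => [|j] jN nuL.
  (* At the first iteration no previous step is available: [r_le] with [sigma 0 = nu0] gives the
     first entry of [nu_max]. *)
  rewrite nuS// nu_0 /nu_max le_max; apply/orP; left.
  rewrite lerD2l ler_wpM2l ?(ltW nu00)// lerXn2r ?nnegrE//.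
    by rewrite addr_ge0// mulr_ge0 ?powR_ge0.
  rewrite (le_trans (r_le jN))// sigma_0//.
  by rewrite lerD// ler_peMl ?powR_ge0// ler1n.
have jN' := ltnW jN; have nuj := nu_gt0 (ltnW jN'); have nuj1 := nu_gt0 jN'.
have B0 := B_ge0.
have nujj : nu j <= nu j.+1.
  by rewrite nuS// lerDl mulr_ge0 ?exprn_ge0// ltW.
set c := nu j / nu j.+1.
have c0 : 0 < c by rewrite divr_gt0.
have c1 : c <= 1 by rewrite ler_pdivrMr// mul1r.
set q : R := p.+1%:R / p%:R.
have q1 : 1 <= q by rewrite ler_pdivlMr// mul1r ler_nat.
set X := (p.+1)`!%:R * G j.+1 / sigma j.+1.
have X0 : 0 <= X by rewrite divr_ge0 ?mulr_ge0// ltW// sigma_gt0.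
have XB : X `^ q <= c * B `^ q * r j ^+ p.+1.
  rewrite -(powR_expr_succ_div p0 (r_ge0 j)).
  apply: (@le_trans _ _ ((c * B * r j ^+ p) `^ q)).
    apply: ge0_ler_powR; rewrite ?nnegrE//.
    - exact: le_trans ler01 q1.
    - by rewrite (mulr_ge0 (mulr_ge0 (ltW c0) B0))// exprn_ge0.
    - exact: grad_ratio_le.
  rewrite powRM ?exprn_ge0 ?(mulr_ge0 (ltW c0) B0)//.
  rewrite powRM ?(ltW c0)// ler_wpM2r ?powR_ge0// ler_wpM2r ?powR_ge0//.
  (* Since [c <= 1] and [q >= 1], the power of [c] is at most [c] itself. *)
  by rewrite -[leRHS](powRr1 (ltW c0)) ger_powR// c0.
have rX : r j.+1 ^+ p.+1 <= 2 ^+ (2 * p + 1) * (et ^+ p.+1 + X `^ q).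
  apply: (@le_trans _ _ ((et + X `^ (p%:R)^-1) ^+ p.+1)).
    by rewrite lerXn2r ?nnegrE ?addr_ge0 ?powR_ge0// r_le.
  rewrite (le_trans (exprD_le _ _ _))// ?powR_ge0//.
  rewrite powR_inv_expr_succ//.
  rewrite ler_wpM2r ?addr_ge0 ?exprn_ge0 ?powR_ge0//.
  by rewrite ler_weXn2l// ?ler1n// addn1 ltnS leq_pmull.
(* The factor [c] cancels [nu j.+1] and leaves [nu j * r j ^+ p.+1], the increment from [nu j] to
   [nu j.+1]. *)
have cE : nu j.+1 * (c * B `^ q * r j ^+ p.+1) <= nu j.+1 * B `^ q.
  have -> : nu j.+1 * (c * B `^ q * r j ^+ p.+1) = (nu j * r j ^+ p.+1) * B `^ q.
    by rewrite /c; field; rewrite gt_eqF.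
  rewrite ler_wpM2r ?powR_ge0//; have := nuS jN'; lra.
have k2 : 0 <= 2 ^+ (2 * p + 1) :> R by rewrite exprn_ge0.
rewrite nuS// /nu_max le_max; apply/orP; right.
apply: (@le_trans _ _ (nu j.+1 * kappa1 p L nu0 theta1 vartheta kappa)).
  have h1 := ler_wpM2l (ltW nuj1) rX.
  have h2 := ler_wpM2l k2 (le_trans (ler_wpM2l (ltW nuj1) XB) cE).
  have e1 : nu j.+1 * (2 ^+ (2 * p + 1) * (et ^+ p.+1 + X `^ q)) =
     nu j.+1 * (2 ^+ (2 * p + 1) * et ^+ p.+1) + 2 ^+ (2 * p + 1) * (nu j.+1 * X `^ q).
    ring.
  have -> : nu j.+1 * kappa1 p L nu0 theta1 vartheta kappa =
     nu j.+1 + (nu j.+1 * (2 ^+ (2 * p + 1) * et ^+ p.+1) +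
        2 ^+ (2 * p + 1) * (nu j.+1 * B `^ q)).
    rewrite /kappa1 -/q; ring.
  by rewrite lerD2l (le_trans h1)// e1 lerD2l.
(* With [kappa1] factored out, what remains is the threshold hypothesis [nuL]. *)
have -> : 2 * kappa1 p L nu0 theta1 vartheta kappa * L / vartheta =
    2 * L / vartheta * kappa1 p L nu0 theta1 vartheta kappa.
  by field; rewrite gt_eqF.
rewrite ler_wpM2r ?(le_trans ler01 (kappa1_ge1 _ _ _ _ _ _))//.
by rewrite ler_pdivlMr// mulrC ltW.
Qed.

Local Notation step_sum k := (\sum_(j < k) r j ^+ p.+1).
Local Notation decr_sum k := (\sum_(j < k) sigma j * r j ^+ p.+1).

Lemma decr_sum_ge0 k : (k <= N)%N -> 0 <= decr_sum k.
Proof.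
move=> kN; apply: sumr_ge0 => j _.
by rewrite mulr_ge0 ?exprn_ge0// ltW// sigma_gt0// (leq_trans (ltn_ord j)).
Qed.

Lemma decr_sum_le k : (k <= N)%N ->
  decr_sum k <= (p.+1)`!%:R * (F 0%N - F k) + L * step_sum k.
Proof.
elim: k => [|k IH] kN; first by rewrite !big_ord0 subrr !mulr0 addr0.
rewrite !big_ord_recr /=; have := IH (ltnW kN); have := F_decr kN.
set a := \sum_(i < k) _; set b := \sum_(i < k) _.
set e := r k ^+ _; lra.
Qed.

Lemma step_sum_le k : (k <= N)%N -> L * step_sum k <= L / nu0 * (nu k - nu0).
Proof.
elim: k => [|k IH] kN; first by rewrite !big_ord0 nu_0 subrr !mulr0.
rewrite big_ord_recr /= mulrDr nuS//.
have e0 : 0 <= r k ^+ p.+1 by rewrite exprn_ge0.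
have : L * r k ^+ p.+1 <= L / nu0 * (nu k * r k ^+ p.+1).
  rewrite -mulrA ler_wpM2l// mulrA ler_peMl// mulrC.
  by rewrite ler_pdivlMr// mul1r nu_ge// ltnW.
have := IH (ltnW kN); lra.
Qed.

(* Up to the last index at which [nu] is below the threshold [2 L / vartheta],
   [step_sum] is controlled by the growth of [nu], which is at most [numax];
   beyond it, each term is at most half of the corresponding decrease. *)
Lemma sum_threshold k : (k <= N)%N -> exists M, [/\ M <= numax,
  L * step_sum k <= L / nu0 * (M - nu0) + 2^-1 * decr_sum k &
  nu k <= M + decr_sum k / vartheta].
Proof.
elim: k => [|k IH] kN.
  exists nu0; rewrite !big_ord0 nu_0 subrr !mulr0 !mul0r !addr0.
  by split => //; exact: nu_max_ge.
have kN' := ltnW kN; have D0 := decr_sum_ge0 kN.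
have [nuL|nuL] := ltP (vartheta * nu k) (2 * L).
  (* Below the threshold [M] is reset: [step_sum_le] controls the whole sum up to here, whatever the
     earlier [M] was. *)
  exists (nu k.+1); split; first exact: nuS_le_numax.
    by rewrite (le_trans (step_sum_le kN))// lerDl mulr_ge0.
  by rewrite lerDl divr_ge0// ltW.
(* Beyond it [M] is kept: [sigma k >= vartheta * nu k >= 2 * L] pays for the new term of the sum and
   for the growth of [nu]. *)
have [M [M1 M2 M3]] := IH kN'; exists M; split => //.
  rewrite !big_ord_recr /= !mulrDr.
  have : L * r k ^+ p.+1 <= 2^-1 * (sigma k * r k ^+ p.+1).
    rewrite mulrA ler_wpM2r ?exprn_ge0//.
    have := sigma_ge kN; lra.
  lra.
rewrite nuS// big_ord_recr /= mulrDl.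
have : nu k * r k ^+ p.+1 <= sigma k * r k ^+ p.+1 / vartheta.
  rewrite mulrAC ler_wpM2r ?exprn_ge0// ler_pdivlMr// mulrC; exact: sigma_ge.
lra.
Qed.

(** Inserting [sum_threshold] into [decr_sum_le] leaves half of [decr_sum k] on the right; absorbing
    it on the left produces the factor 2. *)
Lemma decr_sum_le_Delta k : (k <= N)%N ->
  decr_sum k <= 2 * (p.+1)`!%:R * Delta.
Proof.
move=> kN; have [M [M1 M2 _]] := sum_threshold kN.
have f0 : 0 < (p.+1)`!%:R :> R by rewrite ltr0n fact_gt0.
have := decr_sum_le kN.
have h1 := ler_wpM2l (ltW f0) (F_ge k).
have h2 := ler_wpM2l t0 M1.
have h3 : 0 <= L / nu0 * nu0 by rewrite mulr_ge0// ltW.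
have h4 := mulr_ge0 (ltW vt0) (ltW nu00).
have -> : 2 * (p.+1)`!%:R * Delta = 2 * ((p.+1)`!%:R * (F 0%N - flow)) +
   2 * (L / nu0 * numax) + 2 * (vartheta * nu0).
  by field; rewrite !gt_eqF.
lra.
Qed.

(** [sigma k] is at most [L], an entry of [sigma_max], or at most [nu k], bounded by the third part
    of [sum_threshold] together with [decr_sum_le_Delta]. *)
Lemma sigma_le_max k : (k < N)%N -> sigma k <= sigmax.
Proof.
move=> kN; rewrite (le_trans (sigma_le kN))// /sigma_max.
rewrite ge_max; apply/andP; split; last by rewrite !le_max lexx orbT.
have [M [M1 _ M3]] := sum_threshold (ltnW kN).
rewrite !le_max; apply/orP; left; apply/orP; left.
apply: (le_trans M3); rewrite addrC lerD//.
have -> : 2 * (p.+1)`!%:R / vartheta * Delta = 2 * (p.+1)`!%:R * Delta / vartheta.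
  by rewrite mulrAC.
by rewrite ler_wpM2r ?invr_ge0 ?(ltW vt0)// decr_sum_le_Delta// ltnW.
Qed.

Lemma iterations_le eps : 0 < eps -> (forall j, (j < N)%N -> eps < G j) ->
  N%:R <= 2 * (p.+1)`!%:R * sigmax `^ (p%:R)^-1 *
     ((L / nu0 / vartheta + theta1) / (p`!%:R * eps)) `^ (p.+1%:R / p%:R) *
     Delta + 1.
Proof.
move=> eps0 GN; set w := L / nu0 / vartheta + theta1.
set q : R := p.+1%:R / p%:R.
have w0 : 0 < w by rewrite ltr_wpDl// divr_ge0// ltW.
have f0 : 0 < p`!%:R * eps by rewrite mulr_gt0// ltr0n fact_gt0.
have q0 : 0 <= q by rewrite divr_ge0.
have step j : (j.+1 < N)%N ->
    1 <= sigmax `^ (p%:R)^-1 * (w / (p`!%:R * eps)) `^ q * (sigma j * r j ^+ p.+1).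
  move=> jN; have jN' := ltnW jN; have sj := sigma_gt0 jN'.
  have rp : 0 <= r j ^+ p by rewrite exprn_ge0.
  have h : p`!%:R * eps <= sigma j * w * r j ^+ p.
    apply: le_trans (le_trans (G_le jN') _).
      by rewrite ler_wpM2l// ltW// GN.
    rewrite ler_wpM2r// /w mulrDr [sigma j * theta1]mulrC lerD2r.
    (* [L] becomes a multiple of [sigma j] through [vartheta * nu0 <= sigma j]. *)
    have LE : L = L / nu0 / vartheta * (vartheta * nu0).
      by field; rewrite !gt_eqF.
    rewrite {1}LE mulrC ler_wpM2r ?divr_ge0 ?(ltW vt0) ?(ltW nu00)//.
    apply: le_trans (sigma_ge jN').
    by rewrite ler_wpM2l ?(ltW vt0)// nu_ge// ltnW.
  have {}h : 1 <= sigma j * (w / (p`!%:R * eps)) * r j ^+ p.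
    have -> : sigma j * (w / (p`!%:R * eps)) * r j ^+ p =
      sigma j * w * r j ^+ p / (p`!%:R * eps) by rewrite mulrA mulrAC.
    by rewrite ler_pdivlMr// mul1r.
  have W0 : 0 <= w / (p`!%:R * eps) by rewrite divr_ge0// ltW.
  (* The power [q] turns [r j ^+ p] into [r j ^+ p.+1] and splits off [sigma j] to the power [1/p],
     which is then bounded through [sigmax]. *)
  have : 1 `^ q <= (sigma j * (w / (p`!%:R * eps)) * r j ^+ p) `^ q.
    by apply: ge0_ler_powR; rewrite ?nnegrE// (le_trans ler01 h).
  rewrite powR1 => /le_trans; apply.
  rewrite powRM ?(mulr_ge0 (ltW sj) W0)// powRM ?(ltW sj)//.
  rewrite powR_expr_succ_div// powR_succ_div//.
  have -> : sigma j * sigma j `^ p%:R^-1 * (w / (p`!%:R * eps)) `^ q * r j ^+ p.+1 =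
    sigma j `^ p%:R^-1 * ((w / (p`!%:R * eps)) `^ q * (sigma j * r j ^+ p.+1)).
    ring.
  rewrite -mulrA ler_wpM2r//.
    by rewrite !mulr_ge0 ?powR_ge0 ?exprn_ge0// ltW.
  apply: ge0_ler_powR; rewrite ?nnegrE ?invr_ge0 ?(ltW sj)//.
    exact: le_trans (ltW sj) (sigma_le_max jN').
  exact: sigma_le_max.
set P := sigmax `^ (p%:R)^-1 * (w / (p`!%:R * eps)) `^ q in step *.
have P0 : 0 <= P by rewrite mulr_ge0 ?powR_ge0.
(* [step j] uses the gradient at [j.+1], so only [N.-1] indices are counted; this is the final
   [+ 1]. *)
have NP : N.-1%:R <= P * decr_sum N.-1.
  rewrite -[in leLHS](card_ord N.-1) -sumr_const mulr_sumr; apply: ler_sum => j _.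
  by apply: step; rewrite -ltn_predRL.
have Dle := ler_wpM2l P0 (decr_sum_le_Delta (leq_pred N)).
have : N%:R <= N.-1%:R + 1 :> R by rewrite natr1 ler_nat leqSpred.
move=> /le_trans; apply; rewrite lerD2r (le_trans NP)// (le_trans Dle)//.
by rewrite /P le_eqVlt; apply/orP; left; apply/eqP; ring.
Qed.

End Core.

(** * Estimates for one step of the algorithm *)

Section Step.
Context {R : realType} {n : nat}.
Implicit Types (f : 'rV[R]_n -> R) (x s d u v : 'rV[R]_n).
Implicit Types (L sigma theta kappa : R).

Lemma taylor_upper f p L x s : p = 1%N \/ p = 2%N ->
  continuously_differentiable p f -> lipschitz_nabla p f L ->
  f (x + s) <= taylor f p x s + L / (p.+1)`!%:R * enorm s ^+ p.+1.
Proof. by case=> ->; [exact: taylor1_upper | exact: taylor2_upper]. Qed.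

(** The difference [w] of the two gradients is bounded by duality: the Taylor estimates bound
    [dot w d] for every [d], and [enorm_le_dot] concludes. *)
Lemma grad_upper f p L x s : p = 1%N \/ p = 2%N -> 0 <= L ->
  continuously_differentiable p f -> lipschitz_nabla p f L ->
  p`!%:R * enorm (grad f (x + s)) <=
    L * enorm s ^+ p + p`!%:R * enorm (grad (taylor f p x) s).
Proof.
move=> hp L0 df Lf.
have f0 : 0 < p`!%:R :> R by rewrite ltr0n fact_gt0.
set g := grad f (x + s); set h := grad (taylor f p x) s.
pose w := (-1) *: h + g.
have gE : g = w + h by rewrite /w scaleN1r addrAC addNr add0r.
have gw d : dot w d <= L / p`!%:R * enorm s ^+ p * enorm d.
  have wE : dot w d = 'd f (x + s) d - dot h d.
    rewrite dotDl mulN1r addrC; apply: (congr1 (fun a => a - _)).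
    exact: dot_grad.
  rewrite {}wE {w gE f0}.
  case: hp df Lf @h => -> df Lf h.
    rewrite /h (dot_grad_taylor1 x s d df) divr1; exact: taylor1_grad.
  rewrite /h (dot_grad_taylor2 x s d L0 df Lf).
  have shift (a b c e : R) : a - b <= c + e -> a - (b + c) <= e by lra.
  exact: (shift _ _ _ _ (taylor2_grad x s d df Lf)).
have wle : enorm w <= L / p`!%:R * enorm s ^+ p.
  apply: enorm_le_dot; last exact: gw.
  by rewrite mulr_ge0 ?exprn_ge0 ?enorm_ge0// divr_ge0// ltW.
have := ler_wpM2l (ltW f0) (le_trans (enormD w h) (lerD wle (lexx _))).
rewrite -gE => /le_trans; apply.
by rewrite mulrDr lerD2r mulrA [_ * (L / _)]mulrC divfK// gt_eqF.
Qed.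

Lemma reg_model0 f p x sigma : reg_model f p x sigma 0 = f x.
Proof.
rewrite /reg_model enorm0 expr0n mulr0 addr0 /taylor big_nat big1 ?addr0// => i.
case: i => [//|i] _; have -> : nabla f (nseq i.+1 0) x = 0 by exact: linear0.
by rewrite mulr0.
Qed.

(** A zero step cannot decrease the model strictly. Positivity is needed to clear the quotient
    defining [mu] in [sigma_rule]. *)
Lemma step_rule_neq0 f p theta x sigma s :
  step_rule f p theta x sigma s -> 0 < enorm s.
Proof.
case=> mlt _; rewrite lt_neqAle enorm_ge0 andbT eq_sym; apply/eqP => /enorm_eq0 s0.
by move: mlt; rewrite s0 subrr ltxx.
Qed.

Lemma step_decrease f p theta L x sigma s : p = 1%N \/ p = 2%N ->
  continuously_differentiable p f -> lipschitz_nabla p f L ->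
  step_rule f p theta x sigma s ->
  (p.+1)`!%:R * f (x + s) <=
    (p.+1)`!%:R * f x + (L - sigma) * enorm s ^+ p.+1.
Proof.
move=> hp df Lf [mlt _].
have f0 : 0 < (p.+1)`!%:R :> R by rewrite ltr0n fact_gt0.
move: mlt; rewrite reg_model0 /reg_model => mlt.
have := taylor_upper x s hp df Lf.
set T := taylor f p x s in mlt *; set e := enorm s ^+ _ in mlt *.
set F := f (x + s); set k := (p.+1)`!%:R in f0 mlt * => H.
have : k * F <= k * (f x + (L - sigma) / k * e).
  rewrite ler_pM2l//; move: mlt H; rewrite !mulrBl; lra.
have -> : k * (f x + (L - sigma) / k * e) = k * f x + (L - sigma) * e.
  by field; rewrite gt_eqF.
by [].

Qed.

Lemma step_gradient f p theta L x sigma s : p = 1%N \/ p = 2%N -> 0 <= L ->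
  continuously_differentiable p f -> lipschitz_nabla p f L ->
  step_rule f p theta x sigma s ->
  p`!%:R * enorm (grad f (x + s)) <= (L + theta * sigma) * enorm s ^+ p.
Proof.
move=> hp L0 df Lf [_ gle].
have f0 : 0 < p`!%:R :> R by rewrite ltr0n fact_gt0.
apply: (le_trans (grad_upper x s hp L0 df Lf)).
rewrite mulrDl lerD2l; apply: (le_trans (ler_wpM2l (ltW f0) gle)).
rewrite le_eqVlt; apply/orP; left; apply/eqP; field; exact: lt0r_neq0.
Qed.

Lemma diff_ge_grad f x s : - (enorm (grad f x) * enorm s) <= 'd f x s.
Proof.
rewrite -dot_grad lerNl.
have := cauchy_schwarz (-1 *: grad f x) s.
have -> : dot (-1 *: grad f x) s = - dot (grad f x) s.
  rewrite -[-1 *: _]addr0 dotDl mulN1r [X in _ + X]big1 ?addr0// => i _.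
  by rewrite mxE mul0r.
by rewrite enormZ normrN1 mul1r.
Qed.

Lemma curvature_ge f kappa x s : continuously_differentiable 2 f ->
  (forall d, enorm d <= 1 -> kappa <= nabla f [:: d; d] x) ->
  kappa * enorm s ^+ 2 <= nabla f [:: s; s] x.
Proof.
move=> df kf; have [e e1 se] := enorm_normalize s.
have -> : nabla f [:: s; s] x = nabla f [:: e; e] x * enorm s ^+ 2.
  have sE a : s = a *: e -> nabla f [:: s; s] x = nabla f [:: e; e] x * a ^+ 2.
    move=> ->; apply: (etrans (hessZl f x a e _)).
    apply: (etrans (congr1 (fun b => a * b) (hessZr df x a e e))).
    by rewrite mulrA -expr2 mulrC.
  exact: sE.
by rewrite ler_wpM2r ?sqr_ge0// kf.
Qed.

(** Bounds the solutions of a quadratic inequality without its exact root: if [a] exceeded the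
    right-hand side, [a * (a - b)] would exceed [c]. *)
Lemma le_add_sqrt (a b c : R) : 0 <= a -> 0 <= b -> 0 <= c ->
  a ^+ 2 <= b * a + c -> a <= b + Num.sqrt c.
Proof.
move=> a0 b0 c0 h; rewrite leNgt; apply/negP => ab.
have q0 := sqrtr_ge0 c; have qE := sqr_sqrtr c0.
set q := Num.sqrt c in q0 qE ab.
have : b * a + q ^+ 2 < a ^+ 2 by nra.
rewrite qE; lra.
Qed.

(** Model decrease makes the regularization term smaller than the possible decrease of the Taylor
    terms, which is bounded through the gradient norm and, for [p = 2], the curvature bound.
    Dividing by [enorm s] leaves an inequality of degree [p]. *)
Lemma step_size f p theta x sigma s (nu0 vartheta kappa : R) :
  p = 1%N \/ p = 2%N -> continuously_differentiable p f ->
  (p = 2%N -> forall d, enorm d <= 1 -> kappa <= nabla f [:: d; d] x) ->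
  0 < nu0 -> 0 < vartheta -> vartheta * nu0 <= sigma ->
  step_rule f p theta x sigma s ->
  enorm s <= eta p nu0 vartheta kappa
    + ((p.+1)`!%:R * enorm (grad f x) / sigma) `^ (p%:R)^-1.
Proof.
move=> hp df kf nu00 vt0 sle sr; have s0 := step_rule_neq0 sr.
have sg0 : 0 < sigma by apply: lt_le_trans sle; exact: mulr_gt0.
have [mlt _] := sr; move: mlt; rewrite reg_model0 /reg_model.
have := diff_ge_grad f x s; have g0 := enorm_ge0 (grad f x).
set g := enorm (grad f x) in g0 *; set r := enorm s in s0 *.
case: hp df kf {sr} => -> df kf.
  rewrite taylor1E (_ : 2`!%:R = 2 :> R)//; set D := 'd f x s => Dge mlt.
  rewrite /eta big_geq// add0r invr1 powRr1; last by rewrite divr_ge0 ?mulr_ge0// ltW.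
  rewrite ler_pdivlMr//; have {}mlt : sigma / 2 * r ^+ 2 < g * r by lra.
  have : sigma / 2 * r < g by move: mlt; rewrite expr2 mulrA ltr_pM2r.
  lra.
have := curvature_ge s df (kf erefl); rewrite taylor2E -/r.
rewrite (_ : 3`!%:R = 6 :> R)//; set H := nabla f [:: s; s] x; set D := 'd f x s => Hge Dge mlt.
rewrite /eta big_nat1 subnn add0n invr1 (_ : 3`!%:R = 6 :> R)// (_ : 2`!%:R = 2 :> R)// powRr1; last first.
  by rewrite divr_ge0 ?mulr_ge0 ?le_max ?lexx// ltW.
set m := Num.max 0 (- kappa).
have m0 : 0 <= m by rewrite le_max lexx.
have mk : - kappa <= m by rewrite le_max lexx orbT.
clearbody m H D g r; rewrite powR12_sqrt; last first.
  by rewrite divr_ge0 ?mulr_ge0// ltW.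
apply: le_add_sqrt; [exact: ltW| | |].
- by rewrite divr_ge0 ?mulr_ge0// ltW.
- by rewrite divr_ge0 ?mulr_ge0// ltW.
have h1 : sigma / 6 * r ^+ 2 <= g + m / 2 * r.
  rewrite -(ler_pM2r s0); have := ler_wpM2r (sqr_ge0 r) mk.
  have -> : sigma / 6 * r ^+ 2 * r = sigma / 6 * r ^+ 3 by ring.
  have -> : (g + m / 2 * r) * r = g * r + m * r ^+ 2 / 2 by field.
  lra.
(* The linear coefficient is [3 * m / sigma]; [vartheta * nu0 <= sigma] replaces it by the value of
   [eta]. *)
have h2 : m * 6 / (2 * vartheta * nu0) * r * sigma >= 3 * m * r.
  have -> : m * 6 / (2 * vartheta * nu0) * r * sigma =
    3 * m * r * (sigma / (vartheta * nu0)) by field; rewrite !gt_eqF.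
  rewrite ler_peMr ?ler_pdivlMr ?mul1r ?mulr_gt0// mulr_ge0 ?(ltW s0)//.
  by rewrite mulr_ge0.
rewrite -(ler_pM2r sg0) mulrDl divfK ?gt_eqF//; lra.
Qed.

End Step.

(** * Termination and explicit iteration bounds *)

Lemma stops_within (R : realType) n (f : 'rV[R]_n -> R) (eps1 C : R) x :
  0 <= C -> (forall N : nat, (forall j, (j < N)%N -> eps1 < enorm (grad f (x j))) ->
     N%:R <= C + 1) ->
  exists2 K : nat, stops_at f eps1 x K & (K.+1)%:R <= C + 2.
Proof.
move=> C0 bnd.
have [ex|nex] := pselect (exists k, enorm (grad f (x k)) <= eps1).
  (* With [K] the first index passing the test, [bnd] at [N = K] gives [K <= C + 1]; counting the
     final test gives [C + 2]. *)
  exists (ex_minn ex); case: ex_minnP => K Kle Kmin.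
    by split => // j jK; rewrite ltNge; apply/negP => /Kmin; rewrite leqNgt jK.
  have /bnd : forall j, (j < K)%N -> eps1 < enorm (grad f (x j)).
    by move=> j jK; rewrite ltNge; apply/negP => /Kmin; rewrite leqNgt jK.
  rewrite -natr1; lra.
have C1 : 0 <= C + 1 by rewrite addr_ge0.
(* A run that never stops satisfies [bnd] for every [N], including a natural number above
   [C + 1]. *)
have /bnd : forall j, (j < Num.bound (C + 1))%N -> eps1 < enorm (grad f (x j)).
  by move=> j _; rewrite ltNge; apply/negP => h; apply: nex; exists j.
by have := archi_boundP C1; rewrite ltNge => /negbTE ->.
Qed.

Lemma offar_iterations_le (R : realType) (n p : nat) (f : 'rV[R]_n -> R)
    (flow L kappa : R) (x0 : 'rV[R]_n) (nu0 eps1 theta1 vartheta : R)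
    (x s : nat -> 'rV[R]_n) (sigma nu : nat -> R) (N : nat) :
  p = 1%N \/ p = 2%N -> continuously_differentiable p f ->
  (forall x, flow <= f x) -> 0 <= L -> lipschitz_nabla p f L ->
  (p = 2%N -> forall x d, enorm d <= 1 -> kappa <= nabla f [:: d; d] x) ->
  0 < nu0 -> 0 < eps1 -> 1 < theta1 -> 0 < vartheta <= 1 ->
  offar_run f p x0 nu0 eps1 theta1 vartheta x s sigma nu ->
  (forall j, (j < N)%N -> eps1 < enorm (grad f (x j))) ->
  let g0 := enorm (grad f x0) in
  let numax := nu_max p L nu0 theta1 vartheta kappa g0 in
  let sigmamax := sigma_max p L nu0 theta1 vartheta kappa (f x0) flow g0 in
  N%:R <= 2 * (p.+1)`!%:R * sigmamax `^ (p%:R)^-1 *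
     ((L / nu0 / vartheta + theta1) / (p`!%:R * eps1)) `^ (p.+1%:R / p%:R) *
     (f x0 - flow + ((p.+1)`!%:R)^-1 * (L / nu0 * numax + vartheta * nu0)) + 1.
Proof.
move=> hp df flowP L0 Lf kf nu00 eps0 th1 vt01 [<- nu_0 run] act /=.
have [vt0 vt1] := andP vt01.
have p0 : (0 < p)%N by case: hp => ->.
have {}run j : (j < N)%N -> [/\ sigma_rule f p nu0 theta1 vartheta x s sigma nu j,
    step_rule f p theta1 (x j) (sigma j) (s j), x j.+1 = x j + s j &
    nu j.+1 = nu j + nu j * enorm (s j) ^+ p.+1].
  by move=> jN; apply: run => i ij; apply: act; exact: leq_ltn_trans jN.
have r0 j : 0 <= enorm (s j) by exact: enorm_ge0.
have nuS j : (j < N)%N -> nu j.+1 = nu j + nu j * enorm (s j) ^+ p.+1.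
  by move=> /run[].
have nuge j : (j <= N)%N -> nu0 <= nu j by exact: (nu_ge nu00 r0 nu_0 nuS).
have sigma0 : (0 < N)%N -> sigma 0%N = nu0 by move=> /run[].
have sige j : (j < N)%N -> vartheta * nu j <= sigma j.
  case: j => [|j] jN; last by have [/andP[]] := run _ jN.
  by rewrite sigma0// nu_0 ger_pMl.
have sig_gt0 j : (j < N)%N -> 0 < sigma j.
  move=> jN; apply: lt_le_trans (sige _ jN); rewrite mulr_gt0//.
  exact: lt_le_trans (nuge _ (ltnW jN)).
have Gle j : (j < N)%N -> p`!%:R * enorm (grad f (x j.+1)) <=
    (L + theta1 * sigma j) * enorm (s j) ^+ p.
  move=> /run[_ sr -> _]; exact: step_gradient sr.
apply: (@iterations_le R p N L nu0 theta1 vartheta kappa flow sigma nu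
  (fun j => enorm (s j)) (fun j => enorm (grad f (x j))) (fun j => f (x j))) => //.
- by move=> j; exact: enorm_ge0.
(* The selection rule allows [sigma] up to [mu]; the gradient bound [Gle] at the previous step is
   exactly [mu <= L]. *)
- case=> [|j] jN; first by rewrite sigma0// nu_0 le_max lexx.
  have [/andP[_ sle] _ _ _] := run _ jN; have [_ sr _ _] := run _ (ltnW jN).
  apply: (le_trans sle); rewrite ge_max !le_max lexx/=; apply/orP; right.
  have sp : 0 < enorm (s j) ^+ p by rewrite exprn_gt0// (step_rule_neq0 sr).
  by rewrite lerBlDr ler_pdivrMr// Gle// ltnW.
- move=> j /run[_ sr -> _]; exact: step_decrease sr.
- move=> j jN; have [_ sr _ _] := run _ jN; apply: step_size sr => //.
    by move=> p2 d; exact: kf.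
  by apply: le_trans (sige _ jN); rewrite ler_pM2l// nuge// ltnW.
Qed.

Theorem corollary1 (R : realType) (n p : nat) (f : 'rV[R]_n -> R)
    (flow L : R) (x0 : 'rV[R]_n) (nu0 eps1 theta1 vartheta : R)
    (hn : (1 <= n)%N) (hp : p = 1%N \/ p = 2%N)
    (hf : continuously_differentiable p f)
    (hlow : forall x, flow <= f x)
    (hL0 : 0 <= L) (hL : lipschitz_nabla p f L)
    (hnu0 : 0 < nu0) (heps1 : 0 < eps1 <= 1) (htheta1 : 1 < theta1)
    (hvartheta : 0 < vartheta <= 1) :
  (p = 1%N ->
   let g0 := enorm (grad f x0) in
   let numax := nu_max p L nu0 theta1 vartheta 0 g0 in
   let sigmamax := sigma_max p L nu0 theta1 vartheta 0 (f x0) flow g0 in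
   forall (x s : nat -> 'rV[R]_n) (sigma nu : nat -> R),
   offar_run f p x0 nu0 eps1 theta1 vartheta x s sigma nu ->
   exists2 K : nat, stops_at f eps1 x K &
     (K.+1)%:R <=
       (4 * sigmamax / vartheta ^+ 2 * (L / nu0 + vartheta * theta1) ^+ 2
          * (f x0 - flow + 2^-1 * (L / nu0 * numax + vartheta * nu0))
        + (2 * L / vartheta * (L / nu0 + theta1)) ^+ 2)
       * eps1 ^- 2 + 2)
  /\
  (p = 2%N ->
   forall (kappa_high : R), kappa_high <= 0 ->
   (forall x d, enorm d <= 1 -> kappa_high <= nabla f [:: d; d] x) ->
   let g0 := enorm (grad f x0) in
   let numax := nu_max p L nu0 theta1 vartheta kappa_high g0 in
   let sigmamax :=
     sigma_max p L nu0 theta1 vartheta kappa_high (f x0) flow g0 in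
   forall (x s : nat -> 'rV[R]_n) (sigma nu : nat -> R),
   offar_run f p x0 nu0 eps1 theta1 vartheta x s sigma nu ->
   exists2 K : nat, stops_at f eps1 x K &
     (K.+1)%:R <=
       (12 * sigmamax `^ (1 / 2) / (2 * vartheta) `^ (3 / 2)
          * (L / nu0 + vartheta * theta1) `^ (3 / 2)
          * (f x0 - flow + 6^-1 * (L / nu0 * numax + vartheta * nu0))
        + (L / vartheta * (L / nu0 + theta1)) `^ (3 / 2))
       * eps1 `^ (- (3 / 2)) + 2).
Proof.
have /andP[eps0 _] := heps1; have /andP[vt0 _] := hvartheta.
have t0 : 0 <= L / nu0 by rewrite divr_ge0// ltW.
have th0 : 0 < theta1 := lt_trans ltr01 htheta1.
have w0 : 0 < L / nu0 + vartheta * theta1 by rewrite ltr_wpDl// mulr_gt0.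
have wE : L / nu0 / vartheta + theta1 =
    (L / nu0 + vartheta * theta1) / vartheta by field; rewrite !gt_eqF.
split=> p_eq; [|move=> kappa _ kappaP]; rewrite {}p_eq in hp hf hL *.
- move=> g0 numax sigmamax x s sigma nu run.
  have Delta0 : 0 <= f x0 - flow + 2^-1 * (L / nu0 * numax + vartheta * nu0).
    exact: (gap_ge0 1).
  have smax0 : 0 <= sigmamax by rewrite !le_max (ltW hnu0) orbT.
  apply: stops_within => [|N act].
    rewrite mulr_ge0 ?invr_ge0 ?exprn_ge0 ?(ltW eps0)//.
    rewrite addr_ge0 ?sqr_ge0// mulr_ge0// mulr_ge0 ?sqr_ge0// divr_ge0 ?sqr_ge0//.
    by rewrite mulr_ge0.
  (* For [p = 1] the curvature hypothesis is vacuous and [kappa] is [0]. *)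
  have k0 : 1%N = 2%N -> forall x d : 'rV[R]_n, enorm d <= 1 ->
    0 <= nabla f [:: d; d] x by [].
  have := offar_iterations_le hp hf hlow hL0 hL k0 hnu0 eps0 htheta1 hvartheta run act.
  move=> /le_trans; apply; rewrite lerD2r -/g0 -/numax -/sigmamax.
  have -> : 2%:R / 1%:R = 2%:R :> R by rewrite divr1.
  rewrite invr1 powRr1// (_ : 1`!%:R = 1 :> R)// mul1r powR_mulrn; last first.
    by rewrite wE !divr_ge0// ltW.
  rewrite wE (_ : 2`!%:R = 2 :> R)//.
  set Del := f x0 - flow + _.
  (* The bound obtained equals the first summand of the stated one; the second summand is
     nonnegative. *)
  rewrite [leRHS]mulrDl -[leLHS]addr0 lerD//; last first.
    by rewrite mulr_ge0 ?sqr_ge0// invr_ge0 exprn_ge0// ltW.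
  rewrite le_eqVlt; apply/orP; left; apply/eqP; field.
  by rewrite !gt_eqF.
- move=> g0 numax sigmamax x s sigma nu run.
  have Delta0 : 0 <= f x0 - flow + 6^-1 * (L / nu0 * numax + vartheta * nu0).
    exact: (gap_ge0 2).
  apply: stops_within => [|N act].
    rewrite mulr_ge0 ?powR_ge0// addr_ge0 ?powR_ge0// mulr_ge0//.
    by rewrite mulr_ge0 ?powR_ge0// divr_ge0 ?powR_ge0// mulr_ge0 ?powR_ge0.
  have := offar_iterations_le hp hf hlow hL0 hL (fun _ => kappaP) hnu0 eps0
    htheta1 hvartheta run act.
  move=> /le_trans; apply; rewrite lerD2r -/g0 -/numax -/sigmamax.
  rewrite (_ : 3`!%:R = 6 :> R)// (_ : 2`!%:R = 2 :> R)// div1r.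
  set Del := f x0 - flow + _ in Delta0 *.
  set q : R := 3 / 2.
  (* The factor 2, which is [p!], is grouped with [vartheta] to produce the power of [2 * vartheta]
     in the stated constant. *)
  have -> : (L / nu0 / vartheta + theta1) / (2 * eps1) =
      (L / nu0 + vartheta * theta1) * (2 * vartheta)^-1 * eps1^-1.
    by rewrite wE; field; rewrite !gt_eqF.
  rewrite powRM ?invr_ge0 ?(ltW eps0)//; last first.
    by rewrite mulr_ge0 ?invr_ge0 ?mulr_ge0// ltW.
  rewrite powRM ?invr_ge0 ?(ltW w0) ?mulr_ge0 ?(ltW vt0)//.
  have powV (a : R) : 0 <= a -> a^-1 `^ q = (a `^ q)^-1.
    by move=> a0; rewrite -powR_inv1// -powRrM mulN1r powRN.
  rewrite (powV (2 * vartheta)) ?mulr_ge0 ?(ltW vt0)// (powV eps1) ?(ltW eps0)//.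
  rewrite powRN.
  rewrite [leRHS]mulrDl -[leLHS]addr0 lerD//; last first.
    by rewrite mulr_ge0 ?invr_ge0 ?powR_ge0.
  rewrite le_eqVlt; apply/orP; left; apply/eqP.
  have := powR_gt0 q (mulr_gt0 (ltr0Sn R 1) vt0); have := powR_gt0 q eps0.
  move=> e1 e2; field; by rewrite !gt_eqF.
Qed.
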